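(* Let $S$ be a rectangular domain and let $\xi=(\xi_y)_{y\in S}$, $\xi_y\ge0$, be a birth field on $S$. The last passage percolation value $G_S(\xi)$ is given by the sum of the weights of the broken lines crossing $S$ associated to the corresponding birth field (with zero boundary condition): $G_S(\xi)=H_S(\xi)$.
   Context: Lattice. $\tilde{\mathbb{Z}}^2$ is the set of $(t,x)\in\mathbb{Z}^2$ with $t,x$ both even or both odd; edges $\langle y,y'\rangle$ join points at distance $\sqrt2$. For $y=(t,x)$, the edges $e_y^\nearrow,e_y^\nwarrow,e_y^\searrow,e_y^\swarrow$ join $y$ to $(t+1,x+1)$, $(t-1,x+1)$, $(t+1,x-1)$, $(t-1,x-1)$ respectively. Rectangular domain. $S=\{(t,x)\in\tilde{\mathbb{Z}}^2: a\le t+x\le b,\ c\le t-x\le d\}$ with $a\le b$, $c\le d$ even integers. $\bar S$ is the set of points of $\tilde{\mathbb{Z}}^2$ at distance at most $\sqrt2$ from $S$, $\partial\bar S=\bar S\setminus S$, and $\mathcal{E}(\bar S)$ is the set of edges with at least one endpoint in $S$. Boundaries of $S$: $\partial_-S=\{t+x=a\}$, $\partial_+S=\{t-x=c\}$, $\partial^+S=\{t+x=b\}$, $\partial^-S=\{t-x=d\}$ (subsets of $S$); $\partial_0S$ is the single leftmost point of $S$ ($t+x=a$, $t-x=c$) and $\partial_1S$ the single rightmost point ($t+x=b$, $t-x=d$). Last passage value. $G_S(\xi)=\max_{\pi\in\Pi_S}\sum_{y\in\pi}\xi_y$, where $\Pi_S$ is the set of paths $\pi=(y_0,\dots,y_m)$,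 $y_i=(t_i,x_i)$, with $y_0\in\partial_0S$, $y_m\in\partial_1S$, $t_{i+1}=t_i+1$, $x_{i+1}=x_i\pm1$. Flow field. $\bar\eta=(\eta(e))_{e\in\mathcal{E}(\bar S)}$, $\eta(e)\ge0$, such that $\eta(e_y^\swarrow)-\eta(e_y^\nwarrow)=\eta(e_y^\nearrow)-\eta(e_y^\searrow)$ for every $y\in S$. Write $\zeta^+_y=\eta(e_y^\swarrow)$, $\zeta^-_y=\eta(e_y^\nwarrow)$ (incoming flow), $\eta^+_y=\eta(e_y^\nearrow)$, $\eta_y^-=\eta(e_y^\searrow)$ (outgoing flow). Flow fields are in bijection with pairs $(\zeta^\circ,\xi)$, where $\zeta^\circ=((\zeta^+_y)_{y\in\partial_-S},(\zeta^-_y)_{y\in\partial_+S})\ge0$ (flow entering $S$) and $\xi=(\xi_y)_{y\in S}\ge0$ (birth process), through $\eta_y^\pm=\xi_y+[\zeta_y^\pm-\zeta_y^\mp]^+$; the flow field so obtained is denoted $\bar\eta(\zeta^\circ,\xi)$. Association rules. Given $\bar\eta$, atoms are pairs $(e,p)$ with $e\in\mathcal{E}(\bar S)$, $p\in(0,\eta(e)]$. Atoms on two edges incident to $y\in S$ are associated, $(e_1,p_1)\sim(e_2,p_2)$, exactly in these cases: (1) $e_1=e_y^\swarrow$, $e_2=e_y^\nwarrow$, $p_1=p_2\in(0,\eta(e_1)\wedge\eta(e_2)]$; (2) $e_1=e_y^\searrow$, $e_2=e_y^\nwarrow$, $p_2\in(\eta(e_y^\swarrow),\eta(e_2)]$,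 $p_1=p_2-\eta(e_y^\swarrow)$; (3) $e_1=e_y^\swarrow$, $e_2=e_y^\nearrow$, $p_1\in(\eta(e_y^\nwarrow),\eta(e_1)]$, $p_2=p_1-\eta(e_y^\nwarrow)$; (4) $e_1=e_y^\searrow$, $e_2=e_y^\nearrow$, $p_i\in(\eta(e_i)-\xi_y,\eta(e_i)]$ for $i=1,2$, $\eta(e_1)-p_1=\eta(e_2)-p_2$. For intervals $J=(p,p']$, $|J|=p'-p$, write $(e_1,J_1)\sim(e_2,J_2)$ if every $p_1\in J_1$ has some $p_2\in J_2$ with $(e_1,p_1)\sim(e_2,p_2)$ and vice versa. Broken traces and weights. A broken trace is $\ell=(y_0,e_1,y_1,\dots,e_n,y_n)$, $n\ge1$, with $y_i=(t_i,x_i)\in\tilde{\mathbb{Z}}^2$, $e_i=\langle y_{i-1},y_i\rangle$, $x_i=x_{i-1}+1$, $t_i=t_{i-1}\pm1$. $C(S)$ is the set of broken traces with all $e_i\in\mathcal{E}(\bar S)$ and $y_0,y_n\in\partial\bar S$ (traces crossing $S$). $w_\eta(\ell)$ is the maximum of $|J_1|$ over all broken lines with trace $\ell$ associated with $\bar\eta$, i.e. over intervals $J_i\subseteq(0,\eta(e_i)]$ with $(e_1,J_1)\sim(e_2,J_2)\sim\cdots\sim(e_n,J_n)$ (consecutive pairs associated at $y_1,\dots,y_{n-1}$), and $w_\eta(\ell)=0$ if there is no such non-empty family. $H_S(\zeta^\circ,\xi)$ denotes the common value of the three equal quantities $\sum_{\ell\in C(S)}w_\eta(\ell)$, $\sum_{y\in\partial_-S}\zeta_y^++\sum_{y\in\partial^-S}\eta_y^-$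 and $\sum_{y\in\partial_+S}\zeta_y^-+\sum_{y\in\partial^+S}\eta_y^+$, computed for $\bar\eta=\bar\eta(\zeta^\circ,\xi)$; $H_S(\xi)=H_S(0,\xi)$. *)

(* Defs.v *)
From mathcomp Require Import all_boot all_order all_algebra.
From mathcomp Require Import mathcomp_extra boolp classical_sets functions.
From mathcomp Require Import cardinality fsbigop reals.
From mathcomp Require Import zify.

Set Implicit Arguments.
Unset Strict Implicit.
Unset Printing Implicit Defensive.

Import Order.TTheory GRing.Theory Num.Theory.

Local Open Scope classical_set_scope.
Local Open Scope ring_scope.

(** * Lattice and edges *)

(* A point is [(t, x)]. *)
Definition point : Type := (int * int)%type.

Definition lattice : pred point :=
  fun y => (2 %| y.1)%Z == (2 %| y.2)%Z.

Definition dist2 (y z : point) : int :=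
  (y.1 - z.1) ^+ 2 + (y.2 - z.2) ^+ 2.

(* The unoriented edge <y, z> is stored as the pair of its endpoints, the one
   with smaller [t] first (the endpoints of an edge never have the same [t]). *)
Definition edge : Type := (point * point)%type.

Definition join (y z : point) : edge := if y.1 <= z.1 then (y, z) else (z, y).

Definition is_edge : pred edge := fun e =>
  [&& lattice e.1, lattice e.2, e.1.1 < e.2.1 & dist2 e.1 e.2 == 2].

Definition e_ne (y : point) : edge := join y (y.1 + 1, y.2 + 1).
Definition e_nw (y : point) : edge := join y (y.1 - 1, y.2 + 1).
Definition e_se (y : point) : edge := join y (y.1 + 1, y.2 - 1).
Definition e_sw (y : point) : edge := join y (y.1 - 1, y.2 - 1).

(** * Rectangular domains *)

Record rectangle := Rectangle {
  ra : int; rb : int; rc : int; rd : int;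
  rect_even : [&& (2 %| ra)%Z, (2 %| rb)%Z, (2 %| rc)%Z & (2 %| rd)%Z];
  rect_le : (ra <= rb) && (rc <= rd) }.

Definition dom (S : rectangle) : pred point := fun y =>
  [&& lattice y, ra S <= y.1 + y.2 <= rb S & rc S <= y.1 - y.2 <= rd S].

Definition leftmost (S : rectangle) : pred point := fun y =>
  [&& dom S y, y.1 + y.2 == ra S & y.1 - y.2 == rc S].

Definition rightmost (S : rectangle) : pred point := fun y =>
  [&& dom S y, y.1 + y.2 == rb S & y.1 - y.2 == rd S].

Definition dom_bar (S : rectangle) : set point :=
  [set y | lattice y /\ exists2 z, dom S z & dist2 y z <= 2].

Definition outer_boundary (S : rectangle) : set point :=
  [set y | dom_bar S y /\ ~~ dom S y].

Definition edges_bar (S : rectangle) : pred edge := fun e =>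
  is_edge e && (dom S e.1 || dom S e.2).

(** * Last passage value *)

(* The greatest element of [A], and [0] if there is none. *)
Definition maximum (R : realType) (A : set R) : R := xget 0 (A `&` ubound A).

Definition lpp_step : rel point := fun y z =>
  (z.1 == y.1 + 1) && ((z.2 == y.2 + 1) || (z.2 == y.2 - 1)).

Definition lpp_paths (S : rectangle) : set (seq point) :=
  [set p | exists y0 q, [/\ p = y0 :: q, leftmost S y0,
    path lpp_step y0 q & rightmost S (last y0 q)]].

Definition last_passage (R : realType) (S : rectangle) (xi : point -> R) : R :=
  maximum [set \sum_(y <- p) xi y | p in lpp_paths S].

(** * Flow fields *)

Definition posp (R : realType) (r : R) : R := Num.max r 0.

(* Entering flow: [inflow_p y] enters through [e_sw y] and is only used when
   [y] satisfies [t + x = a]; [inflow_m y] enters through [e_nw y] and is only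
   used when [y] satisfies [t - x = c]. *)
Record inflow (R : realType) := Inflow {
  inflow_p : point -> R;
  inflow_m : point -> R }.

Definition inflow0 (R : realType) : inflow R :=
  Inflow (fun=> 0 : R) (fun=> 0).

(* Recursion from left to right: an edge whose left endpoint is in [S] is an
   outgoing edge of that endpoint, any other edge of [edges_bar S] is an
   entering one. *)
Fixpoint flow_rec (R : realType) (S : rectangle) (zeta : inflow R)
    (xi : point -> R) (n : nat) (e : edge) : R :=
  let: (y, z) := e in
  if dom S y then
    if n is m.+1 then
      let zp := flow_rec S zeta xi m (e_sw y) in
      let zm := flow_rec S zeta xi m (e_nw y) in
      xi y + (if y.2 < z.2 then posp (zp - zm) else posp (zm - zp))
    else 0
  else if y.2 < z.2 then inflow_p zeta z else inflow_m zeta z.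

(* [(a + c) / 2] is the smallest value of [t] on [S], so that the recursion
   depth below is always sufficient: see [flow_ne], [flow_se]. *)
Definition flow (R : realType) (S : rectangle) (zeta : inflow R)
    (xi : point -> R) (e : edge) : R :=
  flow_rec S zeta xi `|e.1.1 - ((ra S + rc S) %/ 2)%Z|.+1 e.

Lemma flow_rec_out (R : realType) S (zeta : inflow R) xi n m e :
  ~~ dom S e.1 -> flow_rec S zeta xi n e = flow_rec S zeta xi m e.
Proof. by case: e => y z /= /negPf; case: n m => [|n] [|m] /= ->. Qed.

Lemma e_swE y : e_sw y = ((y.1 - 1, y.2 - 1), y).
Proof. by rewrite /e_sw /join; case: ifP => //= H; exfalso; lia. Qed.

Lemma e_nwE y : e_nw y = ((y.1 - 1, y.2 + 1), y).
Proof. by rewrite /e_nw /join; case: ifP => //= H; exfalso; lia. Qed.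

Lemma e_neE y : e_ne y = (y, (y.1 + 1, y.2 + 1)).
Proof. by rewrite /e_ne /join; case: ifP => //= H; exfalso; lia. Qed.

Lemma e_seE y : e_se y = (y, (y.1 + 1, y.2 - 1)).
Proof. by rewrite /e_se /join; case: ifP => //= H; exfalso; lia. Qed.

Lemma flow_rec_in (R : realType) S (zeta : inflow R) xi y e :
  dom S y -> e.1.1 = y.1 - 1 ->
  flow_rec S zeta xi `|y.1 - ((ra S + rc S) %/ 2)%Z| e = flow S zeta xi e.
Proof.
move=> Sy ey; rewrite /flow.
have [Se|nSe] := boolP (dom S e.1); last exact: flow_rec_out.
congr (flow_rec _ _ _ _ _); rewrite ey.
move: Se => /and3P[_ /andP[h1 _] /andP[h2 _]].
set t0 := (_ %/ _)%Z; have t0_le : t0 * 2 <= ra S + rc S by exact: lez_floor.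
have {h1 h2}: t0 * 2 <= (y.1 - 1) * 2.
  by apply: le_trans t0_le _; apply: le_trans (lerD h1 h2) _; rewrite ey; lia.
by move: t0 y.1 {Sy ey t0_le} => t0 t; lia.
Qed.

Lemma flow_ne (R : realType) S (zeta : inflow R) xi y : dom S y ->
  flow S zeta xi (e_ne y) = xi y +
    posp (flow S zeta xi (e_sw y) - flow S zeta xi (e_nw y)).
Proof.
move=> Sy; rewrite e_neE {1}/flow /= Sy ifT; last by lia.
by rewrite !flow_rec_in // ?e_swE ?e_nwE.
Qed.

Lemma flow_se (R : realType) S (zeta : inflow R) xi y : dom S y ->
  flow S zeta xi (e_se y) = xi y +
    posp (flow S zeta xi (e_nw y) - flow S zeta xi (e_sw y)).
Proof.
move=> Sy; rewrite e_seE {1}/flow /= Sy ifF; last by lia.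
by rewrite !flow_rec_in // ?e_swE ?e_nwE.
Qed.

Lemma flow_sw (R : realType) S (zeta : inflow R) xi y :
  dom S y -> y.1 + y.2 = ra S -> flow S zeta xi (e_sw y) = inflow_p zeta y.
Proof.
move=> Sy ya; rewrite e_swE /flow /= ifF ?ifT //; first by lia.
by apply/negbTE; rewrite /dom /=; apply/negP => /and3P[_ /andP[]]; lia.
Qed.

Lemma flow_nw (R : realType) S (zeta : inflow R) xi y :
  dom S y -> y.1 - y.2 = rc S -> flow S zeta xi (e_nw y) = inflow_m zeta y.
Proof.
move=> Sy ya; rewrite e_nwE /flow /= ifF ?ifF //; first by lia.
by apply/negbTE; rewrite /dom /=; apply/negP => /and3P[_ _ /andP[]]; lia.
Qed.

(** * Association rules, broken lines and weights *)

Definition assoc (R : realType) (S : rectangle) (xi : point -> R)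
    (eta : edge -> R) (y : point) (e1 : edge) (p1 : R) (e2 : edge) (p2 : R)
    : Prop :=
  dom S y /\
  [\/ [/\ e1 = e_sw y, e2 = e_nw y, p1 = p2 &
          p1 \in `]0, Num.min (eta e1) (eta e2)] ],
      [/\ e1 = e_se y, e2 = e_nw y, p2 \in `]eta (e_sw y), eta e2] &
          p1 = p2 - eta (e_sw y)],
      [/\ e1 = e_sw y, e2 = e_ne y, p1 \in `]eta (e_nw y), eta e1] &
          p2 = p1 - eta (e_nw y)]
    | [/\ e1 = e_se y /\ e2 = e_ne y, p1 \in `]eta e1 - xi y, eta e1],
          p2 \in `]eta e2 - xi y, eta e2] & eta e1 - p1 = eta e2 - p2] ].

(* The pair [J] stands for the interval ]J.1, J.2]. *)
Definition assoc_itv (R : realType) (S : rectangle) (xi : point -> R)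
    (eta : edge -> R) (y : point) (e1 : edge) (J1 : R * R) (e2 : edge)
    (J2 : R * R) : Prop :=
  (forall p1, p1 \in `]J1.1, J1.2] ->
     exists2 p2, p2 \in `]J2.1, J2.2] & assoc S xi eta y e1 p1 e2 p2) /\
  (forall p2, p2 \in `]J2.1, J2.2] ->
     exists2 p1, p1 \in `]J1.1, J1.2] & assoc S xi eta y e1 p1 e2 p2).

(* A trace (y_0, e_1, y_1, ..., e_n, y_n) is given by y_0, ..., y_n, which
   determine its edges. *)
Definition trace_step : rel point := fun y z =>
  (z.2 == y.2 + 1) && ((z.1 == y.1 + 1) || (z.1 == y.1 - 1)).

Definition is_trace : pred (seq point) := fun l =>
  [&& (1 < size l)%N, all lattice l & sorted trace_step l].

Definition tpoint (l : seq point) (i : nat) : point := nth (0, 0) l i.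

(* For 1 <= i <= n. *)
Definition tedge (l : seq point) (i : nat) : edge :=
  join (tpoint l i.-1) (tpoint l i).

Definition crossing (S : rectangle) : set (seq point) :=
  [set l | [/\ is_trace l,
     forall i, (0 < i < size l)%N -> edges_bar S (tedge l i),
     outer_boundary S (tpoint l 0) &
     outer_boundary S (tpoint l (size l).-1)]].

(* [J i] is the interval carried by the i-th edge, 1 <= i <= n = size l - 1;
   the other values of [J] are irrelevant. *)
Definition broken_line (R : realType) (S : rectangle) (xi : point -> R)
    (eta : edge -> R) (l : seq point) (J : nat -> R * R) : Prop :=
  (forall i, (0 < i < size l)%N -> (J i).1 < (J i).2 /\
     {subset `](J i).1, (J i).2] <= `]0, eta (tedge l i)]}) /\
  (forall i, (0 < i)%N -> (i.+1 < size l)%N ->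
     assoc_itv S xi eta (tpoint l i)
       (tedge l i) (J i) (tedge l i.+1) (J i.+1)).

Definition weight (R : realType) (S : rectangle) (xi : point -> R)
    (eta : edge -> R) (l : seq point) : R :=
  maximum [set (J 1%N).2 - (J 1%N).1 | J in broken_line S xi eta l].

(* [crossing S] is finite, so this is a genuine sum. *)
Definition broken_line_total (R : realType) (S : rectangle) (zeta : inflow R)
    (xi : point -> R) : R :=
  \sum_(l \in crossing S) weight S xi (flow S zeta xi) l.

(* Main.v *)
From Pilot Require Import Defs.
From mathcomp Require Import all_boot all_order all_algebra.
From mathcomp Require Import boolp classical_sets fsbigop reals.
From mathcomp Require Import zify lra.
(* [point] must mean a lattice point, not the element of a pointed type. *)
Import Pilot.Defs.

Set Implicit Arguments.
Unset Strict Implicit.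
Unset Printing Implicit Defensive.

Import Order.TTheory GRing.Theory Num.Theory.

Local Open Scope ring_scope.

(** Both sides are equal to the total flow through the edges by which the
    traces enter the domain from below.

    Last passage side.  In the coordinates [(t + x, t - x)] the domain is a
    grid of points [pt S i j].  Let [D i j] be the sum of the flow over the first
    [i] edges between the rows [j.-1] and [j].  Conservation of the flow shows
    that the increments of [D] in both directions are the flow along the
    corresponding edges, and the definition of the outgoing flow then becomes
    [D i.+1 j.+1 = xi (pt S i j) + max (D i j.+1) (D i.+1 j)], which is the
    recursion of the last passage values ([row_flow_rec]).  With no entering flow
    the boundary values are 0, so that the last passage value is the flow through
    all the edges below the last row ([last_passage_row_flow]).

    Broken line side.  At a vertex, the association rules cut the atoms of an
    edge coming from below into two consecutive intervals, one continuing to the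
    north-west and the other to the north-east, each by a translation
    ([assocE], [assoc_itvE]).  Hence the atoms of the first edge of a trace that
    follow the whole trace form an interval, whose length [carried] is computed
    by successive cuts and translations and is the weight of the trace
    ([weight_carried]).  As each cut preserves the total length
    ([transport_split]), the weights of the crossing traces with a given first
    edge add up to the flow through that edge ([sum_carried]).  The first edges
    lie below the last row or enter through the side [t + x = a], and the latter
    carry no flow. *)

(** * Greatest elements and positive parts *)

Lemma maximum_max (R : realType) (A : set R) (v : R) :
  A v -> ubound A v -> maximum A = v.
Proof.
move=> Av ubv; apply: xget_unique; first by split.
by move=> w [Aw ubw]; apply/le_anti; rewrite ubv // ubw.
Qed.

Lemma maximum_empty (R : realType) (A : set R) :
  (forall v, ~ A v) -> maximum A = 0.
Proof. by move=> A0; apply: xgetPN => v [/A0]. Qed.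

Lemma posp_ge0 (R : realType) (r : R) : 0 <= posp r.
Proof. by rewrite /posp le_max lexx orbT. Qed.

Lemma posp_diff (R : realType) (r s : R) : posp (r - s) = posp (s - r) + (r - s).
Proof.
by rewrite /posp; have [h|h] := leP (r - s) 0; have [h'|h'] := leP (s - r) 0; lra.
Qed.

(** * Grid coordinates *)

(** The point with [t + x = a + 2 i] and [t - x = c + 2 j]; the domain consists
    of these points for [i <= wid S] and [j <= hei S]. *)
Definition pt (S : rectangle) (i j : nat) : point :=
  (((ra S + rc S) %/ 2)%Z + i%:Z + j%:Z, ((ra S - rc S) %/ 2)%Z + i%:Z - j%:Z).

(** The largest values of the coordinates [i] and [j] on the domain. *)
Definition wid (S : rectangle) : nat := `|((rb S - ra S) %/ 2)%Z|%N.

Definition hei (S : rectangle) : nat := `|((rd S - rc S) %/ 2)%Z|%N.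

Lemma pt_sum S i j : (pt S i j).1 + (pt S i j).2 = ra S + 2 * i%:Z.
Proof. by case: S => a b c d h1 h2; rewrite /pt /=; lia. Qed.

Lemma pt_diff S i j : (pt S i j).1 - (pt S i j).2 = rc S + 2 * j%:Z.
Proof. by case: S => a b c d h1 h2; rewrite /pt /=; lia. Qed.

Lemma pt_inj S i j i' j' : pt S i j = pt S i' j' -> i = i' /\ j = j'.
Proof.
move=> E; have := pt_sum S i j; have := pt_diff S i j.
by rewrite E pt_sum pt_diff; lia.
Qed.

Lemma widE S : rb S = ra S + 2 * (wid S)%:Z.
Proof. by case: S => a b c d h1 h2; rewrite /wid /=; lia. Qed.

Lemma heiE S : rd S = rc S + 2 * (hei S)%:Z.
Proof. by case: S => a b c d h1 h2; rewrite /hei /=; lia. Qed.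

Lemma lattice_pt S i j : lattice (pt S i j).
Proof. by case: S => a b c d h1 h2; rewrite /lattice /pt /=; lia. Qed.

Lemma dom_pt S i j : dom S (pt S i j) = (i <= wid S)%N && (j <= hei S)%N.
Proof. by rewrite /dom lattice_pt pt_sum pt_diff widE heiE /=; lia. Qed.

Lemma ptP S y : dom S y ->
  exists i j, [/\ (i <= wid S)%N, (j <= hei S)%N & y = pt S i j].
Proof.
case: y => t x Sy.
exists `|((t + x - ra S) %/ 2)%Z|%N, `|((t - x - rc S) %/ 2)%Z|%N.
set i := absz _; set j := absz _.
suff E : (t, x) = pt S i j by move: Sy; rewrite E dom_pt => /andP[].
move: Sy; rewrite /dom /lattice /pt /i /j; case: S {i j} => a b c d h1 h2 /=.
by move=> h; congr pair; lia.
Qed.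

Lemma e_sw_pt S i j : e_sw (pt S i.+1 j) = e_ne (pt S i j).
Proof. by rewrite e_swE e_neE /pt /=; congr (_, _); congr (_, _); lia. Qed.

Lemma e_nw_pt S i j : e_nw (pt S i j.+1) = e_se (pt S i j).
Proof. by rewrite e_nwE e_seE /pt /=; congr (_, _); congr (_, _); lia. Qed.

(** * Last passage percolation and the outgoing flow *)

(** The flow through the edges [e_nw (pt S k j)], [k < i], which carry the flow
    from the row [j.-1] to the row [j].  For [0 < i <= (wid S).+1] and
    [0 < j <= (hei S).+1] it is the last passage value from the leftmost point
    to [pt S i.-1 j.-1], see [lpp_path_le] and [lpp_path_eq]. *)
Definition row_flow (R : realType) S (xi : point -> R) (i j : nat) : R :=
  \sum_(0 <= k < i) flow S (inflow0 R) xi (e_nw (pt S k j)).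

Lemma flow_sw_pt0 (R : realType) S (xi : point -> R) j : (j <= hei S)%N ->
  flow S (inflow0 R) xi (e_sw (pt S 0 j)) = 0.
Proof. by move=> jM; rewrite flow_sw ?dom_pt // pt_sum; lia. Qed.

Lemma flow_nw_pt0 (R : realType) S (xi : point -> R) i : (i <= wid S)%N ->
  flow S (inflow0 R) xi (e_nw (pt S i 0)) = 0.
Proof. by move=> iN; rewrite flow_nw ?dom_pt ?andbT // pt_diff; lia. Qed.

Lemma row_flowSl (R : realType) S (xi : point -> R) i j :
  row_flow S xi i.+1 j
  = row_flow S xi i j + flow S (inflow0 R) xi (e_nw (pt S i j)).
Proof. by rewrite /row_flow big_nat_recr. Qed.

Lemma row_flow0l (R : realType) S (xi : point -> R) j : row_flow S xi 0 j = 0.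
Proof. by rewrite /row_flow big_geq. Qed.

Lemma row_flow0r (R : realType) S (xi : point -> R) i : (i <= (wid S).+1)%N ->
  row_flow S xi i 0 = 0.
Proof.
elim: i => [|i IH] iN; first exact: row_flow0l.
by rewrite row_flowSl IH 1?ltnW // add0r flow_nw_pt0.
Qed.

(** Conservation of the flow at [pt S k j], summed over [k < i]. *)
Lemma row_flowSr (R : realType) S (xi : point -> R) i j :
  (i <= wid S)%N -> (j <= hei S)%N ->
  row_flow S xi i j.+1
  = row_flow S xi i j + flow S (inflow0 R) xi (e_sw (pt S i j)).
Proof.
move=> + jM; elim: i => [|i IH] iN.
  by rewrite !row_flow0l flow_sw_pt0 ?addr0.
have Sij : dom S (pt S i j) by rewrite dom_pt jM ltnW.
rewrite !row_flowSl IH 1?ltnW // e_nw_pt e_sw_pt flow_se // flow_ne //.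
by rewrite posp_diff; lra.
Qed.

Lemma row_flow_rec (R : realType) S (xi : point -> R) i j :
  (i <= wid S)%N -> (j <= hei S)%N ->
  row_flow S xi i.+1 j.+1 =
  xi (pt S i j) + Num.max (row_flow S xi i j.+1) (row_flow S xi i.+1 j).
Proof.
move=> iN jM; rewrite !row_flowSl row_flowSr // e_nw_pt flow_se ?dom_pt ?iN //.
rewrite /posp; set u := flow _ _ _ (e_nw _); set v := flow _ _ _ (e_sw _).
set w := row_flow _ _ _ _.
by have [h|h] := leP (u - v) 0; have [h'|h'] := leP (w + v) (w + u); lra.
Qed.

Lemma lpp_step_pt S i j z :
  lpp_step (pt S i j) z = (z == pt S i.+1 j) || (z == pt S i j.+1).
Proof. by case: z => t x; rewrite /lpp_step /pt /= !xpair_eqE; lia. Qed.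

(** The recursion of [row_flow_rec] bounds the sum over any path. *)
Lemma lpp_path_le (R : realType) S (xi : point -> R) q :
  path lpp_step (pt S 0 0) q ->
  exists i j, last (pt S 0 0) q = pt S i j /\
    ((i <= wid S)%N -> (j <= hei S)%N ->
     \sum_(y <- pt S 0 0 :: q) xi y <= row_flow S xi i.+1 j.+1).
Proof.
elim/last_ind: q => [_|q z IH].
  exists 0%N, 0%N; split=> // iN jM.
  by rewrite big_seq1 row_flow_rec // row_flow0l row_flow0r // maxxx addr0.
rewrite rcons_path last_rcons => /andP[/IH[i [j [-> {}IH]]]].
rewrite lpp_step_pt -rcons_cons -cats1 big_cat big_seq1 /= addrC.
case/orP => /eqP ->; [exists i.+1, j | exists i, j.+1]; split=> // iN jM.
  by rewrite row_flow_rec // lerD2l le_max IH // ltnW.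
by rewrite [leRHS]row_flow_rec // lerD2l le_max IH ?orbT // ltnW.
Qed.

(** Following the larger of the two predecessors backwards attains the bound. *)
Lemma lpp_path_eq (R : realType) S (xi : point -> R) i j :
  (forall y, dom S y -> 0 <= xi y) -> (i <= wid S)%N -> (j <= hei S)%N ->
  exists q, [/\ path lpp_step (pt S 0 0) q, last (pt S 0 0) q = pt S i j &
    \sum_(y <- pt S 0 0 :: q) xi y = row_flow S xi i.+1 j.+1].
Proof.
move=> xi_ge0.
have row_flow_ge0 k l : (k <= (wid S).+1)%N -> (l <= (hei S).+1)%N ->
    0 <= row_flow S xi k l.
  case: l => [|l] kN lM; first by rewrite row_flow0r.
  rewrite /row_flow big_nat_cond sumr_ge0 // => m /andP[/andP[_ mk] _].
  have Sm : dom S (pt S m l) by rewrite dom_pt; lia.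
  by rewrite e_nw_pt flow_se // addr_ge0 ?posp_ge0 ?xi_ge0.
have step k l q y : path lpp_step (pt S 0 0) q -> last (pt S 0 0) q = pt S k l ->
    lpp_step (pt S k l) y -> [/\ path lpp_step (pt S 0 0) (rcons q y),
      last (pt S 0 0) (rcons q y) = y &
      \sum_(z <- pt S 0 0 :: rcons q y) xi z
      = xi y + \sum_(z <- pt S 0 0 :: q) xi z].
  rewrite rcons_path last_rcons => -> -> ->; split=> //.
  by rewrite -rcons_cons -cats1 big_cat big_seq1 /= addrC.
have [n] := ubnP (i + j)%N; elim: n i j => // n IH i j ijn iN jM.
have left_pred k : i = k.+1 -> row_flow S xi k.+2 j <= row_flow S xi k.+1 j.+1 ->
    exists q, [/\ path lpp_step (pt S 0 0) q, last (pt S 0 0) q = pt S i j &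
      \sum_(y <- pt S 0 0 :: q) xi y = row_flow S xi i.+1 j.+1].
  move=> ik le_k; have [|||q [qP qE qS]] := IH k j; [lia|lia|done|].
  have [|p1 p2 p3] := step _ _ _ (pt S i j) qP qE.
    by rewrite lpp_step_pt ik eqxx.
  exists (rcons q (pt S i j)); split=> //.
  by rewrite p3 qS ik [RHS]row_flow_rec ?max_l // -ik.
have right_pred k : j = k.+1 -> row_flow S xi i k.+2 <= row_flow S xi i.+1 k.+1 ->
    exists q, [/\ path lpp_step (pt S 0 0) q, last (pt S 0 0) q = pt S i j &
      \sum_(y <- pt S 0 0 :: q) xi y = row_flow S xi i.+1 j.+1].
  move=> jk le_k; have [|||q [qP qE qS]] := IH i k; [lia|done|lia|].
  have [|p1 p2 p3] := step _ _ _ (pt S i j) qP qE.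
    by rewrite lpp_step_pt jk eqxx orbT.
  exists (rcons q (pt S i j)); split=> //.
  by rewrite p3 qS jk [RHS]row_flow_rec ?max_r // -jk.
case: i j iN jM {ijn} left_pred right_pred => [|i] [|j] iN jM lp rp.
- exists [::]; split=> //.
  by rewrite big_seq1 row_flow_rec // row_flow0l row_flow0r // maxxx addr0.
- by apply: (rp j) => //; rewrite row_flow0l; apply: row_flow_ge0; lia.
- by apply: (lp i) => //; rewrite row_flow0r; [apply: row_flow_ge0|]; lia.
- have [le_ij|/ltW le_ij] :=
    leP (row_flow S xi i.+1 j.+2) (row_flow S xi i.+2 j.+1).
    exact: (rp j).
  exact: (lp i).
Qed.

Lemma last_passage_row_flow (R : realType) S (xi : point -> R) :
  (forall y, dom S y -> 0 <= xi y) ->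
  last_passage S xi = row_flow S xi (wid S).+1 (hei S).+1.
Proof.
move=> xi_ge0.
have leftE y : leftmost S y = (y == pt S 0 0).
  apply/idP/eqP => [/and3P[/ptP[i [j [_ _ ->]]]]|->].
    by rewrite pt_sum pt_diff => h1 h2; congr (pt S); lia.
  by rewrite /leftmost dom_pt pt_sum pt_diff; lia.
have rightE y : rightmost S y = (y == pt S (wid S) (hei S)).
  apply/idP/eqP => [/and3P[/ptP[i [j [_ _ ->]]]]|->].
    by rewrite pt_sum pt_diff widE heiE => h1 h2; congr (pt S); lia.
  by rewrite /rightmost dom_pt pt_sum pt_diff widE heiE; lia.
apply: maximum_max.
  have [q [qP qE qS]] := lpp_path_eq xi_ge0 (leqnn _) (leqnn _).
  exists (pt S 0 0 :: q) => //; exists (pt S 0 0), q.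
  by rewrite leftE rightE qE !eqxx.
move=> v [p [y0 [q [pE]]]]; rewrite leftE rightE => /eqP y0E qP /eqP zE <-.
move: qP zE; rewrite pE y0E => qP zE.
have [i [j []]] := lpp_path_le xi qP.
by rewrite zE => /pt_inj[<- <-]; apply.
Qed.

(** * Vertices of a flow field *)

(** The endpoint of the upward step from [y], to the north-east if [d] and to
    the north-west otherwise. *)
Definition step_up (d : bool) (y : point) : point :=
  (if d then y.1 + 1 else y.1 - 1, y.2 + 1).

Definition step_down (d : bool) (y : point) : point :=
  (if d then y.1 - 1 else y.1 + 1, y.2 - 1).

(** The edge through which a trace with last step [d] reaches [y]. *)
Definition in_edge (d : bool) (y : point) : edge := if d then e_sw y else e_se y.

(** The edge through which a trace with next step [d] leaves [y]. *)
Definition out_edge (d : bool) (y : point) : edge := if d then e_ne y else e_nw y.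

Lemma step_upK d : cancel (step_up d) (step_down d).
Proof. by case: d => -[t x]; rewrite /step_up /step_down /=; congr pair; lia. Qed.

Lemma step_downK d : cancel (step_down d) (step_up d).
Proof. by case: d => -[t x]; rewrite /step_up /step_down /=; congr pair; lia. Qed.

Lemma join_down d y : join (step_down d y) y = in_edge d y.
Proof.
by case: d; rewrite /in_edge ?e_swE ?e_seE /join /step_down /=;
  case: ifP => //; lia.
Qed.

Lemma join_up d y : join y (step_up d y) = out_edge d y.
Proof. by case: d. Qed.

Lemma in_edge_up d y : in_edge d (step_up d y) = out_edge d y.
Proof. by rewrite -join_down step_upK join_up. Qed.

Lemma step_up_lt d y : (y.1 < (step_up d y).1) = d.
Proof. by case: d => /=; lia. Qed.

Lemma trace_stepP y z : reflect (exists d, z = step_up d y) (trace_step y z).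
Proof.
case: y z => [t x] [t' x']; apply: (iffP andP) => /=.
  case=> /eqP-> /orP[] /eqP->; first by exists true.
  by exists false.
by case=> -[] [-> ->]; rewrite !eqxx ?orbT.
Qed.

(** A non-negative flow around each vertex of the domain, generated by the
    non-negative birth process [xi]. *)
Definition flow_field (R : realType) (S : rectangle) (xi : point -> R)
    (eta : edge -> R) : Prop :=
  forall y, dom S y -> [/\ 0 <= xi y, 0 <= eta (e_sw y), 0 <= eta (e_nw y),
    eta (e_ne y) = xi y + posp (eta (e_sw y) - eta (e_nw y)) &
    eta (e_se y) = xi y + posp (eta (e_nw y) - eta (e_sw y))].

Section Vertex.
Context (R : realType) (eta : edge -> R).

(** The atoms of [in_edge d y] up to height [threshold d y] continue to the
    north-west, the other ones to the north-east. *)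
Definition threshold (d : bool) (y : point) : R :=
  if d then Num.min (eta (e_sw y)) (eta (e_nw y))
  else posp (eta (e_nw y) - eta (e_sw y)).

(** The atom of [in_edge d1 y] at height [p] continues, if it does so towards
    [d2], at height [p + offset d1 d2 y]. *)
Definition offset (d1 d2 : bool) (y : point) : R :=
  match d1, d2 with
  | true, false => 0
  | false, false => eta (e_sw y)
  | true, true => - eta (e_nw y)
  | false, true => eta (e_ne y) - eta (e_se y)
  end.

(** The atoms of [out_edge d2 y] associated with those of [in_edge d1 y] whose
    height is in the interval ]J.1, J.2]. *)
Definition transport (d1 d2 : bool) (y : point) (J : R * R) : R * R :=
  ((if d2 then Num.max J.1 (threshold d1 y) else J.1) + offset d1 d2 y,
   (if d2 then J.2 else Num.min J.2 (threshold d1 y)) + offset d1 d2 y).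

(** The two transported intervals share out the length of ]J.1, J.2]. *)
Lemma transport_split d y J :
  posp ((transport d false y J).2 - (transport d false y J).1) +
  posp ((transport d true y J).2 - (transport d true y J).1) =
  posp (J.2 - J.1).
Proof.
have pospP (x : R) : 0 <= x /\ posp x = x \/ x <= 0 /\ posp x = 0.
  by rewrite /posp; have [h|/ltW h] := leP x 0; [right | left].
have subDr (x z c : R) : x + c - (z + c) = x - z by lra.
case: J => a b; rewrite /transport /= !subDr; move: (threshold d y) => u.
have [h1|h1] := leP b u; have [h2|h2] := leP a u.
all: repeat match goal with |- context [posp ?x] =>
  let h := fresh in let e := fresh in case: (pospP x) => -[h e]; rewrite !{}e end.
all: lra.
Qed.

Context (S : rectangle) (xi : point -> R) (eta_flow : flow_field S xi eta).

(** The four association rules as one: being associated is a translation of the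
    heights, on the side of the threshold that [d2] selects. *)
Lemma assocE d1 d2 y p r : dom S y ->
  assoc S xi eta y (in_edge d1 y) p (out_edge d2 y) r <->
  [/\ 0 < p, p <= eta (in_edge d1 y),
      if d2 then threshold d1 y < p else p <= threshold d1 y &
      r = p + offset d1 d2 y].
Proof.
move=> Sy; have [xi0 sw0 nw0 neE seE] := eta_flow Sy.
have d1T : in_edge d1 y = e_sw y -> d1 = true.
  case: (d1) => //; rewrite /in_edge e_swE e_seE.
  by move=> /(congr1 (fun e : edge => e.1.1)) /=; lia.
have d1F : in_edge d1 y = e_se y -> d1 = false.
  case: (d1) => //; rewrite /in_edge e_swE e_seE.
  by move=> /(congr1 (fun e : edge => e.1.1)) /=; lia.
have d2T : out_edge d2 y = e_ne y -> d2 = true.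
  case: (d2) => //; rewrite /out_edge e_nwE e_neE.
  by move=> /(congr1 (fun e : edge => e.1.1)) /=; lia.
have d2F : out_edge d2 y = e_nw y -> d2 = false.
  case: (d2) => //; rewrite /out_edge e_nwE e_neE.
  by move=> /(congr1 (fun e : edge => e.1.1)) /=; lia.
have tT : threshold true y <= eta (e_sw y) by rewrite ge_min lexx.
rewrite /assoc; split.
  case=> _ [].
  - case=> /d1T-> /d2F-> <-; rewrite in_itv /= => /andP[p0 pm].
    by split; rewrite ?addr0 // (le_trans pm).
  - case=> /d1F-> /d2F->; rewrite in_itv /= => /andP[r0 rm] ->.
    rewrite /threshold /= seE /posp.
    by have [h|h] := leP (eta (e_nw y) - eta (e_sw y)) 0;
      split; lra.
  - case=> /d1T-> /d2T->; rewrite in_itv /= => /andP[p0 pm] ->.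
    by split=> //; [lra | rewrite gt_min p0 orbT].
  - case=> -[/d1F-> /d2T->]; rewrite !in_itv /= => /andP[p0 pm] _ pr.
    move: p0; rewrite seE addrAC subrr add0r => p0.
    rewrite /threshold /=.
    split=> //; [exact: le_lt_trans (posp_ge0 _) p0 | rewrite -seE //|lra].
case=> p0 pm pt ->; split=> //.
move=> {d1T d1F d2T d2F}; case: d1 d2 p0 pm pt => [] [] /= p0 pm pt.
- constructor 3; split=> //; rewrite in_itv /= pm andbT.
  by move: pt; rewrite gt_min => /orP[] //; lra.
- by constructor 1; rewrite addr0; split=> //; rewrite in_itv /= p0.
- constructor 4; split=> //; rewrite ?in_itv /=; move: pt pm;
    rewrite /threshold seE => pt pm; try (apply/andP; split); lra.
- constructor 2; split=> //; last by lra.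
  move: pt; rewrite /threshold /posp in_itv /=.
  have [h|h] := leP (eta (e_nw y) - eta (e_sw y)) 0.
    by lra.
  by move=> pt; apply/andP; split; lra.
Qed.
End Vertex.

(** * Broken lines with a given trace *)

Section BrokenLines.
Context (R : realType) (S : rectangle) (xi : point -> R) (eta : edge -> R).

(** The length of the interval which the atoms of ]J.1, J.2] on [in_edge d y]
    that follow the points [l] occupy when they reach the end of [l].  An empty
    interval may be given by unordered bounds, and has length 0. *)
Fixpoint carried (d : bool) (y : point) (J : R * R) (l : seq point) : R :=
  if l is z :: l' then
    carried (y.1 < z.1) z (transport eta d (y.1 < z.1) y J) l'
  else posp (J.2 - J.1).

Context (eta_flow : flow_field S xi eta).

(** On non-empty intervals the association rules amount to a translation. *)
Lemma assoc_itvE d1 d2 y (J1 J2 : R * R) : dom S y ->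
  J1.1 < J1.2 -> J2.1 < J2.2 -> 0 <= J1.1 -> J1.2 <= eta (in_edge d1 y) ->
  assoc_itv S xi eta y (in_edge d1 y) J1 (out_edge d2 y) J2 <->
  (if d2 then threshold eta d1 y <= J1.1 else J1.2 <= threshold eta d1 y) /\
  J2 = (J1.1 + offset eta d1 d2 y, J1.2 + offset eta d1 d2 y).
Proof.
case: J1 J2 => [a b] [a' b'] /= Sy ab ab' a0 bm.
have assocP := assocE eta_flow d1 d2 _ _ Sy.
set c := offset _ _ _ _ in assocP *; set u := threshold _ _ _ in assocP *.
split; last first.
  case=> ut -[-> ->] {a' b' ab'}; split=> p; rewrite !in_itv /= => /andP[pa pb].
    exists (p + c); first by rewrite in_itv /= ltrD2r lerD2r pa.
    apply/assocP; split=> //; [lra|lra|].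
    by case: (d2) ut; lra.
  exists (p - c); first by rewrite in_itv /= ltrBrDr lerBlDr pa.
  apply/assocP; split=> //; [lra|lra| |lra].
  by case: (d2) ut; lra.
case; rewrite /= => f g.
have f' p : a < p -> p <= b ->
    [/\ if d2 then u < p else p <= u, a' < p + c & p + c <= b'].
  move=> pa pb; have [|r] := f p; first by rewrite in_itv /= pa.
  by rewrite in_itv /= => /andP[ra rb] /assocP[_ _ ? rE]; rewrite -rE.
have g' r : a' < r -> r <= b' -> a < r - c /\ r - c <= b.
  move=> pa pb; have [|p] := g r; first by rewrite in_itv /= pa.
  by rewrite in_itv /= => /andP[pa' pb'] /assocP[_ _ _ rE]; rewrite rE addrK.
have [hu _ h1] := f' b ab (lexx _); have [_ h2] := g' b' ab' (lexx _).
have bE : b' = b + c by lra.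
split.
  case: (d2) (f') hu => // {}f' _; rewrite leNgt; apply/negP => au.
  have [] := f' (Num.min b u) => //; first by rewrite lt_min ab.
    by rewrite ge_min lexx.
  by rewrite lt_min ltxx andbF.
congr pair => //; apply/le_anti/andP; split; rewrite leNgt; apply/negP => lt_a.
  have := f' (Num.min b (a' - c)).
  rewrite lt_min ab ltrBrDr lt_a ge_min lexx => /(_ isT isT)[_ + _].
  by have [h|h] := leP b (a' - c); lra.
have := g' (Num.min b' (a + c)).
rewrite lt_min ab' lt_a ge_min lexx => /(_ isT isT)[+ _].
by have [h|h] := leP b' (a + c); lra.
Qed.

Lemma in_itv_sub (a b m : R) : a < b ->
  {subset `]a, b] <= `]0, m]} <-> 0 <= a /\ b <= m.
Proof.
move=> ab; split=> [sub|[a0 bm] p]; last first.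
  by rewrite !in_itv /= => /andP[ap pb]; lra.
have: b \in `]0, m] by apply: sub; rewrite in_itv /= ab lexx.
rewrite in_itv /= => /andP[b0 bm]; split=> //; rewrite leNgt; apply/negP => a0.
have: (Num.min b 0) \in `]0, m].
  by apply: sub; rewrite in_itv /= lt_min ab a0 ge_min lexx.
by rewrite in_itv /= lt_min ltxx andbF.
Qed.

Lemma broken_line2 d y (J : nat -> R * R) :
  broken_line S xi eta [:: step_down d y; y] J <->
  [/\ (J 1%N).1 < (J 1%N).2, 0 <= (J 1%N).1 & (J 1%N).2 <= eta (in_edge d y)].
Proof.
split.
  by case=> /(_ 1%N isT); rewrite /tedge /= join_down => -[h /(in_itv_sub _ h)[]].
case=> h h1 h2; split=> [i /andP[i0 i1]|[|[]]//].
have -> : i = 1%N by apply/eqP; rewrite eqn_leq i0 andbT.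
by split=> //; rewrite /tedge /= join_down; apply/in_itv_sub.
Qed.

Lemma broken_line_cons d y d' l (J : nat -> R * R) :
  broken_line S xi eta (step_down d y :: y :: step_up d' y :: l) J <->
  [/\ (J 1%N).1 < (J 1%N).2, 0 <= (J 1%N).1, (J 1%N).2 <= eta (in_edge d y),
      assoc_itv S xi eta y (in_edge d y) (J 1%N) (out_edge d' y) (J 2) &
      broken_line S xi eta (y :: step_up d' y :: l) (fun i => J i.+1)].
Proof.
split.
  case=> h1 h2; have [h /(in_itv_sub _ h)[]] := h1 1%N isT.
  rewrite /tedge /= join_down => p1 p2.
  split=> //.
    by have := h2 1%N isT isT; rewrite /tedge /= join_down join_up.
  by split=> [[|i] // hi|[|i] // _ hi]; [apply: (h1 i.+2) | apply: (h2 i.+2)].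
case=> h p1 p2 as12 [h1 h2]; split=> [[|[|i]] // hi|[|[|i]] // _ hi].
- by split=> //; apply/in_itv_sub; rewrite // /tedge /= join_down.
- by apply: (h1 i.+1).
- by rewrite /tedge /= join_down join_up.
- by apply: (h2 i.+1).
Qed.

(** An interval associated with a subinterval of ]K.1, K.2] lies in the
    transported interval, and has the same length. *)
Lemma broken_line_le l d y (K : R * R) (J : nat -> R * R) :
  path trace_step y l -> all (dom S) (belast y l) ->
  broken_line S xi eta (step_down d y :: y :: l) J ->
  K.1 <= (J 1%N).1 -> (J 1%N).2 <= K.2 ->
  (J 1%N).2 - (J 1%N).1 <= carried d y K l.
Proof.
elim: l d y K J => [|z l IH] d y K J /=.
  by move=> _ _ _ h1 h2; rewrite le_max; apply/orP; left; lra.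
case/andP => /trace_stepP[d' ->] lP /andP[Sy lS].
move=> /broken_line_cons[J1 J0 Jm as12 bl] K1 K2.
have J2 : (J 2).1 < (J 2).2 by case: bl => /(_ 1%N isT)[].
have /(assoc_itvE d' Sy J1 J2 J0 Jm)[ut JE] := as12.
have -> : (J 1%N).2 - (J 1%N).1 = (J 2).2 - (J 2).1 by rewrite JE /=; lra.
rewrite step_up_lt; apply: (IH d' _ _ (fun i => J i.+1)) => //.
- by rewrite step_upK.
- by rewrite JE /transport /= lerD2r; case: (d') ut; rewrite ?ge_max ?K1.
- by rewrite JE /transport /= lerD2r; case: (d') ut; rewrite ?le_min ?K2.
Qed.

(** Only non-empty intervals matter: the bounds of an empty one are arbitrary. *)
Lemma transport_bounds d d' y (J : R * R) : dom S y ->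
  (J.1 < J.2 -> 0 <= J.1 /\ J.2 <= eta (in_edge d y)) ->
  (transport eta d d' y J).1 < (transport eta d d' y J).2 ->
  0 <= (transport eta d d' y J).1 /\
  (transport eta d d' y J).2 <= eta (out_edge d' y).
Proof.
move=> Sy; have [xi0 sw0 nw0 neE seE] := eta_flow Sy.
case: J => a b; rewrite /transport /threshold; case: d; case: d' => /= ab;
  rewrite ltrD2r ?lt_min ?gt_max => /andP[h1 h2].
- have [a0 bm] := ab h1; move: h2; rewrite neE /posp.
  have [h|h] := leP (eta (e_sw y)) (eta (e_nw y)); first by lra.
  by have [k|k] := leP a (eta (e_nw y));
    have [k'|k'] := leP (eta (e_sw y) - eta (e_nw y)) 0; lra.
- have [a0 bm] := ab h1; rewrite !addr0; split=> //.
  by rewrite !ge_min lexx !orbT.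
- have [a0 bm] := ab h1; rewrite neE; split; last by lra.
  have := posp_ge0 (eta (e_sw y) - eta (e_nw y)).
  have : posp (eta (e_nw y) - eta (e_sw y)) <=
      Num.max a (posp (eta (e_nw y) - eta (e_sw y))).
    by rewrite le_max lexx orbT.
  by lra.
- have [a0 bm] := ab h1; split; first by lra.
  have : Num.min b (posp (eta (e_nw y) - eta (e_sw y))) <=
      posp (eta (e_nw y) - eta (e_sw y)).
    by rewrite ge_min lexx orbT.
  move: h2; rewrite /posp.
  by have [k|k] := leP (eta (e_nw y) - eta (e_sw y)) 0; lra.
Qed.

(** Pulling back the interval carried at the end of the trace gives a broken
    line, which makes the bound of [broken_line_le] optimal. *)
Lemma broken_line_ex l d y (K : R * R) :
  path trace_step y l -> all (dom S) (belast y l) ->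
  (K.1 < K.2 -> 0 <= K.1 /\ K.2 <= eta (in_edge d y)) ->
  0 < carried d y K l ->
  exists J, [/\ broken_line S xi eta (step_down d y :: y :: l) J,
    K.1 <= (J 1%N).1, (J 1%N).2 <= K.2 &
    (J 1%N).2 - (J 1%N).1 = carried d y K l].
Proof.
elim: l d y K => [|z l IH] d y K /=.
  move=> _ _ Km; rewrite /posp; have [|K12 _] := leP (K.2 - K.1) 0.
    by rewrite ltxx.
  have K_lt : K.1 < K.2 by rewrite -subr_gt0.
  by exists (fun=> K); split=> //; apply/broken_line2; have [] := Km K_lt.
case/andP => /trace_stepP[d' ->] lP /andP[Sy lS] Km.
rewrite step_up_lt => /IH[] //.
  by rewrite in_edge_up; apply: transport_bounds.
move=> J; rewrite step_upK => -[bl].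
have J2 : (J 1%N).1 < (J 1%N).2 by case: bl => /(_ 1%N isT)[].
set c := offset eta d d' y; rewrite /transport /= -/c => JK1 JK2 Jlen.
(* The first interval is the next one translated back. *)
pose J1 := ((J 1%N).1 - c, (J 1%N).2 - c).
have [K1 K2 ut] : [/\ K.1 <= J1.1, J1.2 <= K.2 &
    if d' then threshold eta d y <= J1.1 else J1.2 <= threshold eta d y].
  rewrite /J1 /= lerBrDr lerBlDr; move: JK1 JK2.
  case: (d'); rewrite ?addr_maxl ?addr_minl ?ge_max ?le_min.
    by move=> /andP[-> h] ->; split=> //; lra.
  by move=> -> /andP[-> h]; split=> //; lra.
have J1_lt : J1.1 < J1.2 by rewrite /J1 /= ltrD2r.
have [K0 Ke] := Km (le_lt_trans K1 (lt_le_trans J1_lt K2)).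
exists (fun i => if i is i'.+2 then J i'.+1 else J1); split=> //; last first.
  by rewrite -Jlen /J1 /=; lra.
apply/broken_line_cons; split=> //; [exact: le_trans K1|exact: le_trans Ke| |].
  apply/(assoc_itvE d' Sy J1_lt J2); [exact: le_trans K1|exact: le_trans Ke|].
  by split=> //; rewrite /J1 /= !subrK; case: (J 1%N).
case: bl => b1 b2; split=> [[|i] //|[|i] //].
  exact: (b1 i.+1).
exact: (b2 i.+1).
Qed.

Lemma weight_carried l d y :
  path trace_step y l -> all (dom S) (belast y l) ->
  weight S xi eta (step_down d y :: y :: l) =
  carried d y (0, eta (in_edge d y)) l.
Proof.
move=> lP lS; set K := (_, _).
have bound J : broken_line S xi eta (step_down d y :: y :: l) J ->
    0 < (J 1%N).2 - (J 1%N).1 <= carried d y K l.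
  move=> bl; have [/(_ 1%N isT)[J1 /(in_itv_sub _ J1)[]]] := bl.
  rewrite /tedge /= join_down => J0 Jm _.
  by rewrite subr_gt0 J1 (broken_line_le lP lS bl).
have [le0|gt0] := leP (carried d y K l) 0; last first.
  apply: maximum_max.
    have [|J [bl _ _ Jlen]] := broken_line_ex lP lS _ gt0; first by [].
    by exists J.
  by move=> _ [J /bound/andP[_ ?] <-].
have ge0 : 0 <= carried d y K l.
  elim: l d y K {lP lS bound le0} => [|z l IH] d y K /=; first exact: posp_ge0.
  exact: IH.
rewrite /weight maximum_empty; first by apply/le_anti; rewrite le0 ge0.
move=> v [J /bound/andP[h1 h2] _].
by have := lt_le_trans h1 (le_trans h2 le0); rewrite ltxx.
Qed.
End BrokenLines.

(** * Enumeration of the crossing traces *)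

(** The lists [l] such that [y :: l] is a trace which stops at its first point
    outside [S], provided that such a trace has at most [n] steps. *)
Fixpoint exits (S : rectangle) (n : nat) (y : point) : seq (seq point) :=
  if n is m.+1 then
    if dom S y then
      [seq step_up false y :: l | l <- exits S m (step_up false y)] ++
      [seq step_up true y :: l | l <- exits S m (step_up true y)]
    else [:: [::]]
  else [:: [::]].

Lemma carried_cons (R : realType) (eta : edge -> R) d d' y J l :
  carried eta d y J (step_up d' y :: l) =
  carried eta d' (step_up d' y) (transport eta d d' y J) l.
Proof. by rewrite /= step_up_lt. Qed.

(** Each atom of ]J.1, J.2] follows exactly one of the exits. *)
Lemma sum_carried (R : realType) S (eta : edge -> R) n d y J :
  \sum_(l <- exits S n y) carried eta d y J l = posp (J.2 - J.1).
Proof.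
elim: n d y J => [|n IH] d y J; first by rewrite big_seq1.
rewrite [exits _ _ _]/=; case: ifP => _; last by rewrite big_seq1.
rewrite big_cat !big_map -(transport_split eta d y J); congr (_ + _).
  by under eq_bigr do rewrite carried_cons; rewrite IH.
by under eq_bigr do rewrite carried_cons; rewrite IH.
Qed.

Lemma exits_uniq S n (y : point) : uniq (exits S n y).
Proof.
elim: n y => [|n IH] y //=; case: ifP => // _.
rewrite cat_uniq !map_inj_uniq ?IH ?andbT /=; try by move=> ? ? [].
apply/hasPn => _ /mapP[l _ ->]; apply/mapP => -[l' _ []]; lia.
Qed.

(** The number of steps is bounded because [x] increases by 1 at each step and
    is at most [(b - c) / 2] on [S]. *)
Lemma mem_exits S n (y : point) (l : seq point) :
  rb S - rc S < 2 * (y.2 + n%:Z) ->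
  l \in exits S n y =
  [&& path trace_step y l, all (dom S) (belast y l) & ~~ dom S (last y l)].
Proof.
elim: n y l => [|n IH] y l yn /=.
  have nSy : ~~ dom S y by apply/negP => /and3P[_ /andP[? ?] /andP[? ?]]; lia.
  by case: l => [|z l]; rewrite ?inE /= ?nSy // (negPf nSy) andbF.
case: ifPn => Sy; last first.
  by case: l => [|z l]; rewrite ?inE /= ?Sy // (negPf Sy) andbF.
have IHd d l' : l' \in exits S n (step_up d y) = _ := IH _ _ _.
rewrite mem_cat.
have consE d : l \in [seq step_up d y :: l' | l' <- exits S n (step_up d y)] =
    if l is z :: l' then (z == step_up d y) && (l' \in exits S n (step_up d y))
    else false.
  apply/mapP/idP => [[l' l'P ->]|]; first by rewrite eqxx.
  by case: l => // z l' /andP[/eqP-> l'P]; exists l'.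
rewrite !consE; case: l {consE} => [|z l] /=; first by rewrite Sy.
rewrite Sy /=; apply/idP/idP.
  case/orP => /andP[/eqP->]; rewrite IHd /=; try lia.
    by move=> /and3P[-> -> ->]; rewrite !andbT; apply/trace_stepP; exists false.
  by move=> /and3P[-> -> ->]; rewrite !andbT; apply/trace_stepP; exists true.
case/andP => /andP[/trace_stepP[d ->] lP] lS.
have : l \in exits S n (step_up d y) by rewrite IHd /= ?lP //=; lia.
by case: d lP lS => _ _ ->; rewrite eqxx ?orbT.
Qed.

(** A trace that leaves [S] does not come back: [t + x] is non-decreasing and
    [t - x] non-increasing along it. *)
Lemma crossing_tail S (y : point) (l : seq point) :
  lattice y -> dom S y -> path trace_step y l ->
  path (fun z z' => edges_bar S (join z z')) y l -> ~~ dom S (last y l) ->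
  all (dom S) (belast y l).
Proof.
elim: l y => [|z l IH] y //= Ly Sy.
move=> /andP[/trace_stepP[d zE] lP] /andP[_ lE] lS; rewrite Sy.
have Lz : lattice z.
  by move: Ly; rewrite zE /lattice /step_up; case: (d) => /=; lia.
have [Sz|nSz] := boolP (dom S z); first exact: IH.
case: l {IH} lP lE lS => // z' l /= /andP[/trace_stepP[d' z'E] _] /andP[+ _] _.
rewrite z'E join_up /edges_bar => /andP[_].
have nSz' : ~~ dom S (step_up d' z).
  apply/negP => Sz'; case/negP: nSz; move: Sy Sz'; rewrite /dom Lz zE /step_up.
  by case: (d); case: (d') => /=; lia.
by case: d' nSz' {z'E} => nSz'; rewrite /out_edge ?e_neE ?e_nwE /=
  (negPf nSz) ?orbF ?(negPf nSz').
Qed.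

(** The first steps [(d, y)] of the crossing traces, which enter [S] at [y] in
    the direction [d] through its lower boundary. *)
Definition entries (S : rectangle) : seq (bool * point) :=
  [seq (false, pt S i (hei S)) | i <- iota 0 (wid S).+1] ++
  [seq (true, pt S 0 j) | j <- iota 0 (hei S).+1].

Lemma step_down_pt S i j : step_down false (pt S i j) = pt S i j.+1.
Proof. by rewrite /step_down /pt /=; congr pair; lia. Qed.

Lemma step_downS_pt S i j : step_down true (pt S i.+1 j) = pt S i j.
Proof. by rewrite /step_down /pt /=; congr pair; lia. Qed.

Lemma mem_entries S d y :
  ((d, y) \in entries S) = dom S y && ~~ dom S (step_down d y).
Proof.
rewrite mem_cat; apply/idP/idP.
  case/orP => /mapP[i]; rewrite mem_iota add0n ltnS => /andP[_ iN] [-> ->].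
    by rewrite step_down_pt !dom_pt; lia.
  rewrite dom_pt iN /=; apply/negP => /and3P[_ /andP[h _] _].
  by have := pt_sum S 0 i; move: h; rewrite /step_down /=; lia.
case/andP => /ptP[i [j [iN jM ->]]]; case: d.
  case: i iN => [|i] iN; last by rewrite step_downS_pt dom_pt jM ltnW.
  by move=> _; apply/orP; right; apply/mapP; exists j => //; rewrite mem_iota.
rewrite step_down_pt dom_pt iN andTb => nj.
apply/orP; left; apply/mapP; exists i; first by rewrite mem_iota.
by congr (_, pt S _ _); lia.
Qed.

Lemma entries_uniq S : uniq (entries S).
Proof.
rewrite cat_uniq; apply/and3P; split.
- rewrite map_inj_uniq ?iota_uniq // => i i' E.
  by have [] := pt_inj (congr1 snd E).
- by apply/hasPn => _ /mapP[j _ ->]; apply/mapP => -[].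
- rewrite map_inj_uniq ?iota_uniq // => j j' E.
  by have [] := pt_inj (congr1 snd E).
Qed.

(** All the crossing traces: a trace visits at most [wid S + hei S + 1] points
    of [S]. *)
Definition crossings (S : rectangle) : seq (seq point) :=
  [seq step_down s.1 s.2 :: s.2 :: l
    | s <- entries S, l <- exits S (wid S + hei S).+1 s.2].

Lemma crossings_uniq S : uniq (crossings S).
Proof.
have step_down_inj (d d' : bool) (y : point) :
    step_down d y = step_down d' y -> d = d'.
  by case: d d' => [] [] //= /(congr1 fst) /=; lia.
apply: allpairs_uniq_dep; first exact: entries_uniq.
  by move=> s _; apply: exits_uniq.
move=> [[d y] l] [[d' y'] l'] _ _ [h _ yE <-]; move: h; rewrite -yE => h.
by rewrite (step_down_inj d d' y) // /step_down h.
Qed.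

Lemma crossingsP S l : reflect
  (exists d y l', [/\ l = step_down d y :: y :: l', dom S y,
     ~~ dom S (step_down d y) & [&& path trace_step y l',
     all (dom S) (belast y l') & ~~ dom S (last y l')]])
  (l \in crossings S).
Proof.
have fuel y : dom S y ->
    rb S - rc S < 2 * (y.2 + (wid S + hei S).+1%:Z).
  by case/and3P=> _ /andP[? ?] /andP[? ?]; have := widE S; have := heiE S; lia.
apply: (iffP allpairsPdep) => [[[d y] [l' []]]|[d [y [l' [-> Sy nSy l'P]]]]].
  rewrite mem_entries => /andP[Sy nSy].
  by rewrite mem_exits; [move=> l'P ->; exists d, y, l' | exact: fuel].
exists (d, y), l'; split=> //; first by rewrite mem_entries Sy.
by rewrite mem_exits; [exact: l'P | exact: fuel].
Qed.

Lemma lattice_up d y : lattice (step_up d y) = lattice y.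
Proof. by rewrite /lattice /step_up; case: d => /=; lia. Qed.

Lemma lattice_path (y : point) (l : seq point) :
  lattice y -> path trace_step y l -> all lattice l.
Proof.
elim: l y => //= z l IH y Ly /andP[/trace_stepP[d zE] lP].
have Lz : lattice z by rewrite zE lattice_up.
by rewrite Lz (IH z).
Qed.

Lemma dist2_up d y : dist2 y (step_up d y) = 2 /\ dist2 (step_up d y) y = 2.
Proof. by rewrite /dist2 /step_up; case: d => /=; lia. Qed.

Lemma edges_bar_up S d y : lattice y -> dom S y || dom S (step_up d y) ->
  edges_bar S (join y (step_up d y)).
Proof.
rewrite /edges_bar /is_edge join_up => Ly.
have Lz : lattice (step_up d y) by rewrite lattice_up.
have [d1 d2] := dist2_up d y.
case: d Lz d1 d2; rewrite /out_edge ?e_neE ?e_nwE /=; rewrite /step_up /=.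
  by move=> Lz d1 d2 ->; rewrite Ly Lz d1 eqxx; lia.
by move=> Lz d1 d2; rewrite orbC => ->; rewrite Ly Lz d2 eqxx; lia.
Qed.

Lemma crossingE S : crossing S = [set` crossings S]%classic.
Proof.
apply/predeqP => l; split.
  case=> /and3P[l1 lL lT] lE [_ nS0] [_ nSl].
  apply/crossingsP; case: l l1 lL lT lE nS0 nSl => [|y0 [|y l]] //= _.
  move=> /and3P[L0 Ly _] /andP[/trace_stepP[d yE] lP] lE nS0 nSl.
  have y0E : y0 = step_down d y by rewrite yE step_upK.
  have /= /andP[yl_E l_E] :
      path (fun z z' => edges_bar S (join z z')) y0 (y :: l).
    by apply/(pathP (0, 0)) => i il; apply: (lE i.+1).
  have Sy : dom S y.
    move: yl_E; rewrite /edges_bar y0E join_down => /andP[_].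
    move: nS0; rewrite y0E; case: (d); rewrite /in_edge ?e_swE ?e_seE /=.
      by rewrite /tpoint /= => /negPf; rewrite /step_down => ->.
    by rewrite /tpoint /= => /negPf; rewrite /step_down => ->; rewrite orbF.
  have nSl' : ~~ dom S (last y l).
    by have /= <- := nth_last (0, 0) (y0 :: y :: l).
  exists d, y, l; split=> //; rewrite -?y0E // lP nSl' andbT /=.
  exact: crossing_tail.
case/crossingsP => d [y [l' [-> Sy nSy /and3P[lP lS nSl]]]].
have Ly : lattice y by case/andP: Sy.
have Ld : lattice (step_down d y) by rewrite -(lattice_up d) step_downK.
have stepd : trace_step (step_down d y) y.
  by apply/trace_stepP; exists d; rewrite step_downK.
split.
- by rewrite /is_trace /= Ld Ly (lattice_path Ly lP) stepd.
- have E : path (fun z z' => edges_bar S (join z z')) (step_down d y) (y :: l').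
    rewrite /= -{2}(step_downK d y) edges_bar_up ?step_downK ?Sy ?orbT //=.
    elim: l' y Sy Ly lP lS {nSy nSl Ld stepd} => //= z l' IH y Sy Ly.
    move=> /andP[/trace_stepP[d' ->] lP] /andP[_ lS].
    rewrite edges_bar_up ?Sy //=; case: l' IH lP lS => //= z' l' IH lP lS.
    by apply: IH; rewrite ?lattice_up //; case/andP: lS.
  by move=> [|i] // il; apply: (pathP (0, 0) E i).
- split=> //; split=> //; exists y => //.
  have [d1 _] := dist2_up d (step_down d y).
  by move: d1; rewrite step_downK => ->.
rewrite /tpoint nth_last /=; split=> //.
case/lastP: l' lP lS nSl => [|l' z]; first by rewrite /= Sy.
rewrite rcons_path belast_rcons last_rcons => /andP[lP /trace_stepP[d' ->]] lS _.
have Sl : dom S (last y l') by apply: (allP lS); apply: mem_last.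
split; first by rewrite lattice_up; case/andP: Sl.
by exists (last y l') => //; have [_ ->] := dist2_up d' (last y l').
Qed.

(** * The identity *)

Lemma flow_field_flow (R : realType) S (xi : point -> R) :
  (forall y, dom S y -> 0 <= xi y) ->
  flow_field S xi (flow S (inflow0 R) xi).
Proof.
move=> xi_ge0 y Sy; split; [exact: xi_ge0| | |exact: flow_ne|exact: flow_se].
  case/ptP: Sy => -[|i] [j [iN jM ->]]; first by rewrite flow_sw_pt0.
  have Sij : dom S (pt S i j) by rewrite dom_pt jM ltnW.
  by rewrite e_sw_pt flow_ne // addr_ge0 ?posp_ge0 ?xi_ge0.
case/ptP: Sy => i [[|j] [iN jM ->]]; first by rewrite flow_nw_pt0.
have Sij : dom S (pt S i j) by rewrite dom_pt iN ltnW.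
by rewrite e_nw_pt flow_se // addr_ge0 ?posp_ge0 ?xi_ge0.
Qed.

(** Each atom of an edge entering [S] from below follows exactly one crossing
    trace. *)
Lemma broken_line_total_entries (R : realType) S (xi : point -> R) :
  (forall y, dom S y -> 0 <= xi y) ->
  broken_line_total S (inflow0 R) xi =
  \sum_(s <- entries S) flow S (inflow0 R) xi (in_edge s.1 s.2).
Proof.
move=> xi_ge0; have eta_flow := flow_field_flow xi_ge0.
rewrite /broken_line_total crossingE -fsbig_seq ?crossings_uniq //.
rewrite big_allpairs_dep; apply: eq_big_seq => -[d y] dyS /=.
have := dyS; rewrite mem_entries => /andP[Sy nSy].
have eta_ge0 : 0 <= flow S (inflow0 R) xi (in_edge d y).
  have [xi0 sw0 nw0 _ seE] := eta_flow y Sy.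
  by case: (d) => //=; rewrite seE addr_ge0 ?posp_ge0.
transitivity (posp (flow S (inflow0 R) xi (in_edge d y) - 0)); last first.
  by rewrite subr0 /posp max_l.
rewrite -(sum_carried S (flow S (inflow0 R) xi) (wid S + hei S).+1 d y (0, _)).
apply: eq_big_seq => l lS.
have /crossingsP[d' [y' [l' [E _ _ /and3P[lP lS' _]]]]] :
    step_down d y :: y :: l \in crossings S.
  by apply/allpairsPdep; exists (d, y), l.
case: E => _ _ yE lE; rewrite -yE -lE in lP lS'.
exact: weight_carried.
Qed.

Theorem proposition2p1 (R : realType) (S : rectangle) (xi : point -> R)
    (xi_ge0 : forall y : point, dom S y -> 0 <= xi y) :
  last_passage S xi = broken_line_total S (inflow0 R) xi.
Proof.
rewrite last_passage_row_flow // broken_line_total_entries //.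
have sw0 : \sum_(j <- iota 0 (hei S).+1)
    flow S (inflow0 R) xi (e_sw (pt S 0 j)) = 0.
  apply: big1_seq => j /andP[_]; rewrite mem_iota => /andP[_ jM].
  exact: flow_sw_pt0.
rewrite big_cat !big_map -[LHS]addr0; congr (_ + _); last exact/esym.
by rewrite /row_flow /index_iota subn0; apply: eq_bigr => i _; rewrite e_nw_pt.
Qed.
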